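(* Let $p$ be an odd prime, let $n\ge 1$, and let $F$ be a field with $\operatorname{char}(F)\neq p$ and $\mu_p\not\subseteq F$. Let $L=F(\mu_p)$ and $M=F(\mu_{p^n})$. Then there are group isomorphisms: (i) $L^*/L^{*p^n}\cong (M^*/M^{*p^n})^{\mathrm{Gal}(M/L)}$; (ii) $F^*/F^{*p^n}\cong (L^*/L^{*p^n})^{\mathrm{Gal}(L/F)}\cong (M^*/M^{*p^n})^{\mathrm{Gal}(M/F)}$.
   Context: For $m\ge1$, $\mu_m$ denotes the group of $m$-th roots of unity in a fixed algebraic closure of $F$. For a field $K$, $K^{*p^n}$ denotes the group of $p^n$-th powers of elements of $K^*$. For a group $G$ acting on an abelian group $A$, $A^G$ denotes the subgroup of fixed elements; the Galois groups act on the power class groups in the natural way. *)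

(* Defs.v *)
From HB Require Import structures.
From mathcomp Require Import all_boot all_order all_fingroup all_algebra.
From mathcomp Require Import all_solvable all_field.
From mathcomp Require Import boolp generic_quotient.

Set Implicit Arguments.
Unset Strict Implicit.
Unset Printing Implicit Defensive.

Import GRing.Theory.

Local Open Scope ring_scope.
Local Open Scope quotient_scope.

(* [groupType] is the type of possibly infinite groups; all the groups below
   are abelian and written multiplicatively. *)
Definition isomorphic (G H : groupType) : Prop :=
  exists f : {multiplicative G -> H}, bijective f.

(* The multiplicative group K^* of a field K. *)
Section UnitGroup.
Variable K : fieldType.

Record star := Star { star_val : K; star_neq0 : star_val != 0 }.

HB.instance Definition _ := [isSub for star_val].
HB.instance Definition _ := [Choice of star by <:].

Definition star_mul (x y : star) : star :=
  Star (mulf_neq0 (star_neq0 x) (star_neq0 y)).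
Definition star_one : star := Star (oner_neq0 K).
Definition star_inv (x : star) : star := Star (invr_neq0 (star_neq0 x)).

Fact star_mulA : associative star_mul.
Proof. by move=> x y z; apply/val_inj; apply: mulrA. Qed.
Fact star_mulC : commutative star_mul.
Proof. by move=> x y; apply/val_inj; apply: mulrC. Qed.
Fact star_mul1 : left_id star_one star_mul.
Proof. by move=> x; apply/val_inj; apply: mul1r. Qed.
Fact star_1mul : right_id star_one star_mul.
Proof. by move=> x; apply/val_inj; apply: mulr1. Qed.
Fact star_mulV : left_inverse star_one star_inv star_mul.
Proof. by move=> x; apply/val_inj; apply: mulVf; apply: star_neq0. Qed.
Fact star_Vmul : right_inverse star_one star_inv star_mul.
Proof. by move=> x; apply/val_inj; apply: mulfV; apply: star_neq0. Qed.

HB.instance Definition _ :=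
  isGroup.Build star star_mulA star_mul1 star_1mul star_mulV star_Vmul.

End UnitGroup.

(* The quotient group K^* / K^{*m}. *)
Section PowerClassGroup.
Variables (K : fieldType) (m : nat).
Implicit Types x y : star K.

Definition powcl_rel x y : bool :=
  `[< exists z : star K, (x * y^-1 = z ^+ m)%g >].

Let star_commute x y : commute x y. Proof. exact: star_mulC. Qed.

Fact powcl_rel_equiv : equiv_class_of powcl_rel.
Proof.
split=> [x|x y|y x z].
- by apply/asboolP; exists 1%g; rewrite expg1n divgg.
- apply/asboolP/asboolP=> -[z zE]; exists (z^-1)%g.
    by rewrite expVgn -zE invgF.
  by rewrite expVgn -zE invgF.
- move=> /asboolP[u uE] /asboolP[v vE]; apply/asboolP; exists (u * v)%g.
  by rewrite expgMn // -uE -vE -mulgA mulKg.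
Qed.

Canonical powcl_equiv := EquivRelPack powcl_rel_equiv.

Definition powcl : Type := {eq_quot powcl_equiv}.
HB.instance Definition _ := Choice.on powcl.
HB.instance Definition _ := EqQuotient.on powcl.

Definition powcl_mul (a b : powcl) : powcl := \pi_powcl (repr a * repr b)%g.
Definition powcl_inv (a : powcl) : powcl := \pi_powcl ((repr a)^-1)%g.

Fact powclP x y :
  reflect (exists z : star K, (x * y^-1 = z ^+ m)%g)
          (\pi_powcl x == \pi_powcl y).
Proof. by rewrite piE; apply: asboolP. Qed.

Fact powclW (P : powcl -> Prop) :
  (forall x, P (\pi_powcl x)) -> forall a, P a.
Proof. by move=> Ppi a; rewrite -[a]reprK. Qed.

Fact powcl_reprP x : exists z : star K, (repr (\pi_powcl x) * x^-1 = z ^+ m)%g.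
Proof. by apply/powclP; rewrite reprK. Qed.

Fact powcl_mul_pi x y :
  powcl_mul (\pi_powcl x) (\pi_powcl y) = \pi_powcl (x * y)%g.
Proof.
apply/eqP/powclP.
have [u uE] := powcl_reprP x; have [v vE] := powcl_reprP y.
exists (u * v)%g; rewrite expgMn // -uE -vE invgM -!mulgA.
by congr (_ * _)%g; rewrite mulgA; apply: star_commute.
Qed.

Fact powcl_inv_pi x : powcl_inv (\pi_powcl x) = \pi_powcl (x^-1)%g.
Proof.
apply/eqP/powclP; have [u uE] := powcl_reprP x.
by exists (u^-1)%g; rewrite expVgn -uE invgM star_commute.
Qed.

Fact powcl_mulA : associative powcl_mul.
Proof.
elim/powclW=> x; elim/powclW=> y; elim/powclW=> z.
by rewrite !powcl_mul_pi mulgA.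
Qed.
Fact powcl_mul1 : left_id (\pi_powcl 1%g) powcl_mul.
Proof. by elim/powclW=> x; rewrite powcl_mul_pi mul1g. Qed.
Fact powcl_1mul : right_id (\pi_powcl 1%g) powcl_mul.
Proof. by elim/powclW=> x; rewrite powcl_mul_pi mulg1. Qed.
Fact powcl_mulV : left_inverse (\pi_powcl 1%g) powcl_inv powcl_mul.
Proof. by elim/powclW=> x; rewrite powcl_inv_pi powcl_mul_pi mulVg. Qed.
Fact powcl_Vmul : right_inverse (\pi_powcl 1%g) powcl_inv powcl_mul.
Proof. by elim/powclW=> x; rewrite powcl_inv_pi powcl_mul_pi mulgV. Qed.

HB.instance Definition _ :=
  isGroup.Build powcl powcl_mulA powcl_mul1 powcl_1mul powcl_mulV powcl_Vmul.

End PowerClassGroup.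

(* The map K^*/K^{*m} -> K'^*/K'^{*m} induced by a field morphism K -> K'. *)
Section Functoriality.
Variables (K K' : fieldType) (f : {rmorphism K -> K'}) (m : nat).

Fact star_map_subproof (x : star K) : f (val x) != 0.
Proof. by rewrite fmorph_eq0; apply: star_neq0. Qed.
Definition star_map (x : star K) : star K' := Star (star_map_subproof x).

Fact star_mapM : {morph star_map : x y / (x * y)%g}.
Proof. by move=> x y; apply/val_inj; apply: rmorphM. Qed.
HB.instance Definition _ :=
  isMultiplicative.Build (star K) (star K') star_map star_mapM.

Fact star_map1 : star_map 1%g = 1%g.
Proof. by apply/val_inj; apply: rmorph1. Qed.
Fact star_mapV x : star_map (x^-1)%g = ((star_map x)^-1)%g.
Proof. by apply/val_inj; apply: fmorphV. Qed.
Fact star_mapX x k : star_map (x ^+ k)%g = (star_map x ^+ k)%g.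
Proof. by elim: k => [|k IHk]; rewrite ?star_map1 // !expgS star_mapM IHk. Qed.

Definition powcl_map (a : powcl K m) : powcl K' m :=
  \pi_(powcl K' m) (star_map (repr a)).

Fact powcl_map_pi x :
  powcl_map (\pi_(powcl K m) x) = \pi_(powcl K' m) (star_map x).
Proof.
apply/eqP/powclP; have [z zE] := powcl_reprP m x.
by exists (star_map z); rewrite -star_mapX -zE star_mapM star_mapV.
Qed.

Fact powcl_mapM : {morph powcl_map : a b / (a * b)%g}.
Proof.
elim/powclW=> x; elim/powclW=> y.
by rewrite [(_ * _)%g]powcl_mul_pi !powcl_map_pi [RHS]powcl_mul_pi star_mapM.
Qed.
HB.instance Definition _ :=
  isMultiplicative.Build (powcl K m) (powcl K' m) powcl_map powcl_mapM.

Fact powcl_map1 : powcl_map 1%g = 1%g.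
Proof. by rewrite [1%g in LHS]/1%g /= powcl_map_pi star_map1. Qed.
Fact powcl_mapV a : powcl_map (a^-1)%g = ((powcl_map a)^-1)%g.
Proof.
elim/powclW: a => x.
by rewrite [(_^-1)%g]powcl_inv_pi !powcl_map_pi [RHS]powcl_inv_pi star_mapV.
Qed.

End Functoriality.

Section GaloisAction.
Variables (F : fieldType) (E : splittingFieldType F) (K : {subfield E}).

(* An element s of [gal_of K] acts on the ambient field E, and maps K to K;
   [subvs_of K] is K seen as a field on its own. *)
Definition gal_res (s : gal_of K) (x : subvs_of K) : subvs_of K :=
  vsproj K (s (vsval x)).

Fact gal_resE s x : vsval (gal_res s x) = s (vsval x).
Proof. by rewrite vsprojK // memv_gal // subvsP. Qed.

Fact gal_res_is_zmod_morphism s : zmod_morphism (gal_res s).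
Proof.
move=> x y; apply: (@val_inj _ _ (subvs_of K)).
have valE (a : subvs_of K) : val a = vsval a by [].
by rewrite !valE [RHS]linearB /= !gal_resE -rmorphB -linearB.
Qed.
Fact gal_res_is_monoid_morphism s : monoid_morphism (gal_res s).
Proof.
have valE (a : subvs_of K) : val a = vsval a by [].
split=> [|x y]; apply: (@val_inj _ _ (subvs_of K)); rewrite !valE.
  by rewrite gal_resE (rmorph1 vsval) rmorph1.
by rewrite [RHS]rmorphM /= !gal_resE -!rmorphM.
Qed.
HB.instance Definition _ s := GRing.isZmodMorphism.Build
  (subvs_of K) (subvs_of K) (gal_res s) (gal_res_is_zmod_morphism s).
HB.instance Definition _ s := GRing.isMonoidMorphism.Build
  (subvs_of K) (subvs_of K) (gal_res s) (gal_res_is_monoid_morphism s).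

Variables (m : nat) (G : {set gal_of K}).

Definition gal_fixed : pred (powcl (subvs_of K) m) :=
  [pred a | [forall s in G, powcl_map (gal_res s) a == a]].

(* The group (K^* / K^{*m})^G of Galois-invariant power classes. *)
Record powcl_fix :=
  PowclFix {
    powcl_fix_val : powcl (subvs_of K) m; _ : gal_fixed powcl_fix_val }.

HB.instance Definition _ := [isSub for powcl_fix_val].
HB.instance Definition _ := [Choice of powcl_fix by <:].

Fact gal_fixed_group_closed : group_closed gal_fixed.
Proof.
split=> [|a b /forall_inP fixa /forall_inP fixb].
  by apply/forall_inP=> s _; rewrite powcl_map1.
apply/forall_inP=> s Gs; rewrite powcl_mapM powcl_mapV.
by rewrite (eqP (fixa s Gs)) (eqP (fixb s Gs)).
Qed.

HB.instance Definition _ := SubChoice_isSubGroup.Build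
  (powcl (subvs_of K) m) gal_fixed powcl_fix gal_fixed_group_closed.

End GaloisAction.

(* K = F(mu_m), where E, a finite normal extension of F, stands for the part of
   the algebraic closure in use: X^m - 1 splits in E, and K is generated over F
   (which sits in E as the subspace 1) by its roots. *)
Definition is_adjoin_mu (F : fieldType) (E : splittingFieldType F)
    (m : nat) (K : {subfield E}) : Prop :=
  splittingFieldFor 1 ('X^m - 1) K.

(* mu_m is contained in F; meaningful when X^m - 1 splits in E. *)
Definition mu_sub_base (F : fieldType) (E : splittingFieldType F) (m : nat)
    : Prop :=
  forall z : E, m.-unity_root z -> z \in 1%VS.

(* Main.v *)
(* Write q = p^n, let zeta be a primitive q-th root of unity generating M over K
   (K = L or K = F), and let s generate Gal(M/K), which is cyclic since (Z/q)^*
   is. Say s(zeta) = zeta^c, let d be the order of s and S = 1 + c + ... +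
   c^(d-1), so that N(zeta) = zeta^S. As d is the order of c modulo q and p is
   odd, gcd(q, c-1) gcd(q, S) divides q; this encodes the vanishing of
   H^i(Gal(M/K), mu_q) for i > 0.
   - If y^q is in K, then s(y) = y zeta^a; taking norms, q | a S, hence
     a + b (c-1) = 0 mod q for some b, and y zeta^b is in K.
   - If s(y) = y z^q, then N(z) = zeta^e is fixed by s, so q | e (c-1), hence
     e + b S = 0 mod q for some b; then N(z zeta^b) = 1, and Hilbert 90 gives
     z zeta^b = w / s(w), so that y w^q is in K.
   These are the injectivity and surjectivity of K^*/q -> (M^*/q)^Gal(M/K). The
   isomorphism F^*/q -> (L^*/q)^Gal(L/F) follows by descending from M to F, and
   correcting the q-th roots by the injectivity of L^*/q -> M^*/q. *)
Require Import Defs.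
From HB Require Import structures.
From mathcomp Require Import all_boot all_order all_fingroup all_algebra.
From mathcomp Require Import all_solvable all_field.
From mathcomp Require Import generic_quotient zify.

Set Implicit Arguments.
Unset Strict Implicit.
Unset Printing Implicit Defensive.

Import GRing.Theory.

(** * Arithmetic of geometric sums modulo powers of an odd prime *)

Lemma geom_sumM c a b :
  \sum_(i < a * b) c ^ i = (\sum_(i < a) c ^ i) * \sum_(j < b) (c ^ a) ^ j.
Proof.
elim: b => [|b IHb]; first by rewrite muln0 !big_ord0 muln0.
rewrite mulnS addnC big_split_ord /= IHb big_ord_recr mulnDr; congr (_ + _).
rewrite big_distrl /=.
by apply: eq_bigr => i _; rewrite expnD expnM mulnC.
Qed.

Lemma pred_exp_geom_sum c d :
  0 < c -> (c ^ d).-1 = c.-1 * \sum_(i < d) c ^ i.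
Proof. by case: c => // c _; rewrite predn_exp. Qed.

(** Put c = 1 + u p. Modulo p^2, c^i is 1 + i u p, so the sum is p + C(p,2) u p, and p divides
    C(p,2) because p is odd. *)
Lemma geom_sum_prime p c : prime p -> odd p -> 0 < c -> p %| c.-1 ->
  exists r, \sum_(i < p) c ^ i = p * (1 + p * r).
Proof.
move=> p_pr p_odd c_gt0 /dvdnP[u uE].
have cE : c = 1 + u * p by lia.
have expc i : exists r, c ^ i = 1 + i * (u * p) + p * p * r.
  elim: i => [|i [r IHi]]; first by exists 0; rewrite expn0; lia.
  by exists (i * u * u + r + r * u * p); rewrite expnSr IHi cE; lia.
have sum_expc m : exists r,
    \sum_(i < m) c ^ i = m + 'C(m, 2) * (u * p) + p * p * r.
  elim: m => [|m [r IHm]]; first by exists 0; rewrite big_ord0 bin0n; lia.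
  have [s sE] := expc m.
  by exists (r + s); rewrite big_ord_recr /= IHm sE binS bin1; lia.
have [r rE] := sum_expc p.
have /dvdnP[v vE] : p %| 'C(p, 2).
  by apply: prime_dvd_bin; rewrite ?odd_prime_gt2.
by exists (u * v + r); rewrite rE vE; lia.
Qed.

(** Induction on j: the sum of length p^(j+1) is the sum of length p^j times the sum of length p
    with base c^(p^j), which is still 1 modulo p. *)
Lemma geom_sum_pfactor p c j : prime p -> odd p -> 0 < c -> p %| c.-1 ->
  exists2 u, coprime p u & \sum_(i < p ^ j) c ^ i = p ^ j * u.
Proof.
move=> p_pr p_odd c_gt0 p_c; elim: j => [|j [u co_pu IHj]].
  by exists 1; rewrite ?coprimen1 // expn0 big_ord1.
have [||r rE] := @geom_sum_prime p (c ^ (p ^ j)) p_pr p_odd.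
- by rewrite expn_gt0 c_gt0.
- by rewrite pred_exp_geom_sum // dvdn_mulr.
exists (u * (1 + p * r)).
  by rewrite coprimeMr co_pu addnC mulnC /coprime gcdnMDl gcdn1.
by rewrite expnSr geom_sumM IHj rE; lia.
Qed.

(** The units form the automorphism group of a cyclic group of order p^n, which is cyclic for odd
    p. *)
Lemma units_Zp_pfactor_cyclic p n :
  prime p -> odd p -> 0 < n -> cyclic (units_Zp (p ^ n)).
Proof.
move=> p_pr p_odd n_gt0.
have q_gt1 : 1 < p ^ n by rewrite -{1}(exp1n n) ltn_exp2r // prime_gt1.
pose x : 'Z_(p ^ n) := Zp1.
have ox : #[x]%g = (p ^ n) by rewrite /x order_Zp1 Zp_cast.
rewrite -ox (isog_cyclic (Zp_unit_isog x)).
have px : (p.-group <[x]>)%g by rewrite /pgroup -orderE ox pnatX pnat_id.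
have ntx : <[x]>%g != 1%g by rewrite -cardG_gt1 -orderE ox.
have [m [_ [_ cF _ _]]] := cyclic_pgroup_Aut_structure px (cycle_cyclic x) ntx.
case: eqP => [_ AutF|_ [t [_ _ _]]]; first by rewrite -AutF in cF.
by rewrite p_odd => -[[]].
Qed.

(** In Z/q, the annihilator of x lies in the ideal of y: q divides a gcd(q,x), hence gcd(q,y)
    divides a, and by Bezout gcd(q,y) is a multiple of y modulo q. *)
Lemma gcdn_annihilator q x y a : 0 < q -> gcdn q x * gcdn q y %| q ->
  q %| a * x -> exists b, q %| a + b * y.
Proof.
move=> q_gt0 gxy qax.
have /dvdnP[a' ->] : gcdn q y %| a.
  rewrite -(@dvdn_pmul2l (gcdn q x)) ?gcdn_gt0 ?q_gt0 //.
  by apply: dvdn_trans gxy _; rewrite mulnC muln_gcdr dvdn_gcd qax dvdn_mull.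
have [k _ qk] := Bezoutl y q_gt0.
by exists (a' * k); rewrite -mulnA -mulnDr dvdn_mull.
Qed.

(** Here d is the order of c modulo p^n. If p divides c - 1, then d is some p^j, the sum has p-part
    p^j, and it remains to bound j; otherwise the first gcd is 1. *)
Lemma gcdn_geom_sum p n c d : prime p -> odd p -> 0 < c ->
  (forall i, (c ^ i == 1 %[mod p ^ n]) = (d %| i)) ->
  gcdn (p ^ n) c.-1 * gcdn (p ^ n) (\sum_(i < d) c ^ i) %| p ^ n.
Proof.
move=> p_pr p_odd c_gt0 c_order.
have [p_c|p'c] := boolP (p %| c.-1); last first.
  have /eqP-> : coprime (p ^ n) c.-1 by rewrite coprimeXl ?prime_coprime.
  by rewrite mul1n dvdn_gcdl.
have /(dvdn_pfactor _ _ p_pr)[k le_kn gcdE] := dvdn_gcdl (p ^ n) c.-1.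
(* The product of c - 1 and the sum of length p^(n-k) is divisible by p^k p^(n-k), so c^(p^(n-k)) =
   1 modulo p^n. *)
have /(dvdn_pfactor _ _ p_pr)[j le_j dE] : d %| p ^ (n - k).
  rewrite -c_order eqn_mod_dvd ?expn_gt0 ?c_gt0 // subn1 pred_exp_geom_sum //.
  have [u _ ->] := geom_sum_pfactor (n - k) p_pr p_odd c_gt0 p_c.
  rewrite mulnA dvdn_mulr // -{1}(subnKC le_kn) expnD dvdn_mul //.
  by rewrite -gcdE dvdn_gcdr.
rewrite dE gcdE; have [u co_pu ->] := geom_sum_pfactor j p_pr p_odd c_gt0 p_c.
have gj : gcdn (p ^ n) (p ^ j * u) %| p ^ j.
  rewrite -(@Gauss_dvdl _ _ u) ?dvdn_gcdr //.
  by apply: coprime_dvdl (dvdn_gcdl _ _) _; rewrite coprimeXl.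
apply: dvdn_trans (dvdn_mul (dvdnn _) gj) _.
by rewrite -expnD dvdn_exp2l // -leq_subRL.
Qed.

Local Open Scope ring_scope.
Local Open Scope quotient_scope.

Lemma big_cycle (R : Type) (idx : R) (op : Monoid.com_law idx)
    (gT : finGroupType) (x : gT) (f : gT -> R) :
  \big[op/idx]_(y in <[x]>%g) f y = \big[op/idx]_(i < #[x]%g) f (x ^+ i)%g.
Proof.
have ->: <[x]>%g = [set (x ^+ val i)%g | i : 'I_#[x]%g].
  apply/setP=> y; apply/idP/imsetP=> [/cyclePmin[i lti ->]|[i _ ->]].
    by exists (Ordinal lti).
  exact: mem_cycle.
rewrite big_imset //= => i j _ _ /eqP.
by rewrite eq_expg_ord // => /eqP.
Qed.

Lemma gal_expg_root (F : fieldType) (E : splittingFieldType F)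
    (M : {subfield E}) (s : gal_of M) (zeta : E) (c i : nat) :
  zeta \in M -> s zeta = zeta ^+ c -> (s ^+ i)%g zeta = zeta ^+ (c ^ i).
Proof.
move=> M_zeta s_zeta; elim: i => [|i IHi]; first by rewrite gal_id.
by rewrite expgSr galM // IHi rmorphXn /= s_zeta -exprM expnS.
Qed.

(** * Descent of roots and of power classes along a cyclic extension *)

Section Descent.

Variables (F : fieldType) (E : splittingFieldType F) (K M : {subfield E}).
Variables (q c : nat) (zeta : E) (s : gal_of M).
Hypotheses (galKM : galois K M) (gen_s : generator 'Gal(M / K)%g s).
Hypotheses (prim_zeta : q.-primitive_root zeta) (M_zeta : zeta \in M).
Hypotheses (s_zeta : s zeta = zeta ^+ c) (c_gt0 : (0 < c)%N).

Local Notation S := (\sum_(i < #[s]%g) c ^ i)%N.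
Hypothesis gcd_cS : (gcdn q c.-1 * gcdn q S %| q)%N.

Let GalE : 'Gal(M / K)%g = <[s]>%g. Proof. exact/eqP. Qed.
Let Gal_s : s \in 'Gal(M / K)%g. Proof. by rewrite GalE cycle_id. Qed.
Let q_gt0 : (0 < q)%N. Proof. exact: prim_order_gt0 prim_zeta. Qed.
Let zetaX_neq0 i : zeta ^+ i != 0.
Proof. by rewrite expf_neq0 // (prim_root_eq0 prim_zeta) -lt0n. Qed.

Let galNorm_zeta : galNorm K M zeta = zeta ^+ S.
Proof.
rewrite /galNorm GalE big_cycle -prodrXr.
by apply: eq_bigr => i _; apply: gal_expg_root.
Qed.

Let gen_fixed x : x \in M -> s x = x -> x \in K.
Proof.
move=> Mx sx; rewrite -(galois_fixedField galKM); apply/fixedFieldP=> // t.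
rewrite GalE => /cycleP[i ->].
by elim: i => [|i IHi]; rewrite ?gal_id // expgSr galM // IHi.
Qed.

(** The obstruction to y lying in K is a cocycle zeta^a, which the gcd condition turns into a
    coboundary. *)
Lemma root_descent y : y \in M -> y ^+ q \in K ->
  exists2 w, w \in K & w ^+ q = y ^+ q.
Proof.
move=> My Kyq.
have [->|y_neq0] := eqVneq y 0; first by exists 0; rewrite ?mem0v.
have [a sy] : exists a, s y = y * zeta ^+ a.
  have /(prim_rootP prim_zeta)[a aE] : (s y / y) ^+ q = 1.
    rewrite exprMn -rmorphXn /= (fixed_gal _ Gal_s) //; last first.
      by case/and3P: galKM.
    by rewrite -exprMn divff // expr1n.
  by exists a; rewrite -aE mulrC divfK.
(* As s y and y have the same norm, the norm zeta^(a S) of zeta^a is 1. *)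
have q_aS : (q %| a * S)%N.
  have: galNorm K M (s y) = galNorm K M (y * zeta ^+ a) by rewrite sy.
  rewrite galNorm_gal // galNormM galNormX galNorm_zeta -exprM.
  rewrite -[LHS]mulr1 => /mulfI; rewrite galNorm_eq0 => /(_ y_neq0) /eqP.
  by rewrite eq_sym -(prim_order_dvd prim_zeta) mulnC.
have gcd_Sc : (gcdn q S * gcdn q c.-1 %| q)%N by rewrite mulnC.
have [b q_b] := gcdn_annihilator q_gt0 gcd_Sc q_aS.
exists (y * zeta ^+ b); last first.
  by rewrite exprMn exprAC (prim_expr_order prim_zeta) expr1n mulr1.
apply: gen_fixed; first by rewrite rpredM ?rpredX.
rewrite rmorphM rmorphXn /= s_zeta sy -mulrA -exprM -exprD; congr (_ * _).
(* The image of y zeta^b under s is y zeta^(a + c b), whose exponent exceeds b by a + b (c - 1), a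
   multiple of q. *)
have ->: (a + c * b = (a + b * c.-1) + b)%N.
  by rewrite -{1}(prednK c_gt0) mulSn mulnC [(b + _)%N]addnC addnA.
have /eqP zeta_ab : zeta ^+ (a + b * c.-1) == 1.
  by rewrite -(prim_order_dvd prim_zeta).
by rewrite exprD zeta_ab mul1r.
Qed.

(** Multiplying z by a power of zeta leaves z^q unchanged and can be made to bring the norm of z to
    1, where Hilbert 90 applies. *)
Lemma class_descent y z : y \in M -> z \in M -> y != 0 ->
  s y = y * z ^+ q -> exists w, [/\ w \in M, w != 0 & y * w ^+ q \in K].
Proof.
move=> My Mz y_neq0 sy.
have Nz_q : galNorm K M z ^+ q = 1.
  have: galNorm K M (s y) = galNorm K M (y * z ^+ q) by rewrite sy.
  rewrite galNorm_gal // galNormM galNormX.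
  by rewrite -[LHS]mulr1 => /mulfI; rewrite galNorm_eq0 => /(_ y_neq0).
have [e Nz] := prim_rootP prim_zeta Nz_q.
(* The norm zeta^e of z lies in K, so s fixes it. *)
have q_ec : (q %| e * c.-1)%N.
  have /(fixed_gal _ Gal_s): galNorm K M z \in K by apply: mem_galNorm.
  rewrite Nz rmorphXn /= s_zeta -exprM -{1}(prednK c_gt0) mulSn exprD.
  rewrite -[RHS]mulr1 => fix_e.
  rewrite (prim_order_dvd prim_zeta) mulnC; apply/eqP/(mulfI (zetaX_neq0 e)).
  by apply: fix_e; case/and3P: galKM.
have [b q_b] := gcdn_annihilator q_gt0 gcd_cS q_ec.
have Mzb : z * zeta ^+ b \in M by rewrite rpredM ?rpredX.
have : galNorm K M (z * zeta ^+ b) == 1.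
  rewrite galNormM galNormX galNorm_zeta Nz -exprM -exprD mulnC.
  by rewrite -(prim_order_dvd prim_zeta).
case/(Hilbert's_theorem_90 gen_s Mzb) => w [Mw w_neq0] zw.
exists w; split=> //; apply: gen_fixed; first by rewrite rpredM ?rpredX.
have zqE : z ^+ q = (w / s w) ^+ q.
  by rewrite -zw exprMn exprAC (prim_expr_order prim_zeta) expr1n mulr1.
rewrite rmorphM rmorphXn /= sy zqE -mulrA -exprMn divfK //.
by rewrite fmorph_eq0.
Qed.

End Descent.

(** * The cyclotomic character *)

Section Cyclotomic.

Variables (F : fieldType) (E : splittingFieldType F) (K : {subfield E}).
Variables (q : nat) (zeta : E).
Hypothesis prim_zeta : q.-primitive_root zeta.
Local Notation M := <<K; zeta>>%AS.

Fact cyclotomic_char_subproof (s : gal_of M) : (s zeta) ^+ q = 1.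
Proof. by rewrite -rmorphXn /= (prim_expr_order prim_zeta) rmorph1. Qed.

(** A chosen exponent, determined only modulo q. *)
Definition cyclotomic_char (s : gal_of M) : nat :=
  sval (prim_rootP prim_zeta (cyclotomic_char_subproof s)).

Lemma cyclotomic_charE (s : gal_of M) : s zeta = zeta ^+ cyclotomic_char s.
Proof. by rewrite /cyclotomic_char; case: prim_rootP. Qed.

Lemma coprime_cyclotomic_char (s : gal_of M) : coprime q (cyclotomic_char s).
Proof.
rewrite coprime_sym -(prim_root_exp_coprime _ prim_zeta) -cyclotomic_charE.
by rewrite fmorph_primitive_root.
Qed.

(** The character embeds the Galois group into the units of Z/q, since an automorphism over K is
    determined by its value at zeta. *)
Lemma cyclotomic_gal_cyclic :
  (1 < q)%N -> cyclic (units_Zp q) -> cyclic 'Gal(M / K)%g.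
Proof.
move=> q_gt1 cyc_units.
pose chi (s : gal_of M) : {unit 'Z_q} := FinRing.Unit
  (etrans (unitZpE (cyclotomic_char s) q_gt1) (coprime_cyclotomic_char s)).
have chiE s t : (chi s == chi t) = (s zeta == t zeta).
  rewrite -val_eqE /= !cyclotomic_charE (eq_prim_root_expr prim_zeta).
  by rewrite -val_eqE /= !val_Zp_nat.
have chiM : {in 'Gal(M / K)%g &, {morph chi : s t / (s * t)%g}}.
  move=> s t _ _; apply/val_inj; rewrite /= -natrM; apply/val_inj.
  rewrite /= !val_Zp_nat //; apply/eqP.
  rewrite -(eq_prim_root_expr prim_zeta) -cyclotomic_charE.
  rewrite galM ?memv_adjoin // cyclotomic_charE rmorphXn /=.
  by rewrite cyclotomic_charE -exprM mulnC.
pose f := Morphism chiM.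
have inj_f : ('injm f)%g.
  apply/injmP=> s t Gs Gt /eqP; rewrite /= chiE => st.
  by apply/eqP; rewrite (gal_adjoin_eq Gs Gt).
rewrite -(injm_cyclic inj_f) //; apply: cyclicS cyc_units.
by apply/subsetP=> u _; rewrite inE.
Qed.

End Cyclotomic.

(** * Descent for q = p^n *)

Section PrimePowerDescent.

Variables (F : fieldType) (E : splittingFieldType F) (K M : {subfield E}).
Variables (p n : nat) (zeta : E).
Hypotheses (p_pr : prime p) (p_odd : odd p) (n_gt0 : (0 < n)%N).
Hypotheses (prim_zeta : (p ^ n)%N.-primitive_root zeta).
Hypotheses (defM : M = <<K; zeta>>%AS) (galKM : galois K M).

Let q_gt1 : (1 < p ^ n)%N.
Proof. by rewrite -{1}(exp1n n) ltn_exp2r // prime_gt1. Qed.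

Let M_zeta : zeta \in M. Proof. by rewrite defM memv_adjoin. Qed.

(** Supplies the data for the cyclic descent: the order of s is that of c modulo p^n, so the gcd
    bound holds. *)
Lemma cyclotomic_generator : exists s : gal_of M, exists c : nat,
  [/\ generator 'Gal(M / K)%g s, s zeta = zeta ^+ c, (0 < c)%N
    & (gcdn (p ^ n) c.-1 * gcdn (p ^ n) (\sum_(i < #[s]%g) c ^ i)
        %| p ^ n)%N].
Proof.
have := cyclotomic_gal_cyclic K prim_zeta q_gt1
          (units_Zp_pfactor_cyclic p_pr p_odd n_gt0).
rewrite -defM => /cyclicP[s GalE]; exists s.
have Gal_s : s \in 'Gal(M / K)%g by rewrite GalE cycle_id.
have /(prim_rootP prim_zeta)[c s_zeta] : (s zeta) ^+ (p ^ n) = 1.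
  by rewrite -rmorphXn /= (prim_expr_order prim_zeta) rmorph1.
(* With c = 0 the primitive root s(zeta) would be 1, while p^n > 1. *)
have c_gt0 : (0 < c)%N.
  have := prim_zeta; rewrite -(fmorph_primitive_root s) /= s_zeta.
  rewrite prim_root_exp_coprime //; case: posnP => // ->.
  by rewrite /coprime gcd0n gtn_eqF.
exists c; split=> //; first by rewrite /generator GalE.
apply: gcdn_geom_sum => // i.
(* The power s^i is trivial exactly when it fixes zeta. *)
rewrite -(eq_prim_root_expr prim_zeta) -(gal_expg_root i M_zeta s_zeta) expr1 order_dvdn.
rewrite -[X in _ == X](gal_id M zeta).
have: (s ^+ i)%g \in 'Gal(M / K)%g by rewrite groupX.
move: (s ^+ i)%g (group1 'Gal(M / K)%G); rewrite defM => t G1 Gt.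
by rewrite (gal_adjoin_eq Gt G1).
Qed.

Lemma pfactor_root_descent y : y \in M -> y ^+ (p ^ n) \in K ->
  exists2 w, w \in K & w ^+ (p ^ n) = y ^+ (p ^ n).
Proof.
have [s [c [gen_s s_zeta c_gt0 gcd_cS]]] := cyclotomic_generator.
exact: (root_descent galKM gen_s prim_zeta M_zeta s_zeta c_gt0 gcd_cS).
Qed.

Lemma pfactor_class_descent y : y \in M -> y != 0 ->
    (forall s, s \in 'Gal(M / K)%g ->
      exists2 z, z \in M & s y = y * z ^+ (p ^ n)) ->
  exists w, [/\ w \in M, w != 0 & y * w ^+ (p ^ n) \in K].
Proof.
move=> My y_neq0 y_fix.
have [s [c [gen_s s_zeta c_gt0 gcd_cS]]] := cyclotomic_generator.
have /y_fix[z Mz sy] : s \in 'Gal(M / K)%g by rewrite (eqP gen_s) cycle_id.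
exact: (class_descent galKM gen_s prim_zeta M_zeta s_zeta c_gt0 gcd_cS) sy.
Qed.

End PrimePowerDescent.

(** * Fields generated by roots of unity *)

(** As m is nonzero in F, X^m - 1 is separable: its splitting field is Galois, and among its m
    distinct roots there is a primitive one, whose powers are all of them. *)
Lemma adjoin_mu_primitive_root (F : fieldType) (E : splittingFieldType F)
    (m : nat) (M : {subfield E}) :
  m%:R != 0 :> F -> is_adjoin_mu m M ->
  galois 1 M /\ exists2 zeta, m.-primitive_root zeta & M = <<1; zeta>>%AS.
Proof.
move=> m_neq0 muM.
have m_gt0 : (0 < m)%N by rewrite lt0n; apply: contraNneq m_neq0 => ->.
have mE_neq0 : m%:R != 0 :> E.
  by rewrite -(rmorph_nat (in_alg E)) fmorph_eq0.
have sep : separable_poly ('X^m - 1 : {poly E}) by apply: separable_Xn_sub_1.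
split.
  apply/splitting_galoisField; exists ('X^m - 1); split=> //.
  by rewrite rpredB ?rpredX ?polyOverX ?rpred1.
have [rs Drs defM] := muM.
have rsP z : (z \in rs) = (z ^+ m == 1).
  by rewrite -root_prod_XsubC -(eqp_root Drs) -unity_rootE.
have [||||zeta _ prim_zeta] := hasP (@has_prim_root E m rs _ _ _ _).
- by [].
- by apply/allP=> z; rewrite rsP unity_rootE.
- by rewrite -separable_prod_XsubC -(eqp_separable Drs).
- by rewrite -ltnS -(size_prod_XsubC rs id) -(eqp_size Drs) size_XnsubC.
exists zeta => //; apply/val_inj; rewrite /= -defM; apply/eqP.
rewrite eqEsubv; apply/andP; split.
  apply/Fadjoin_seqP; split=> [|z]; first exact: sub1v.
  rewrite rsP => /eqP/(prim_rootP prim_zeta)[i ->].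
  by rewrite rpredX ?memv_adjoin.
apply/FadjoinP; split; first exact: sub1v.
by apply: seqv_sub_adjoin; rewrite rsP (prim_expr_order prim_zeta).
Qed.

(** * Isomorphisms between power class groups *)

Lemma isomorphicP (G H : groupType) (f : G -> H) :
  {morph f : x y / (x * y)%g} -> injective f -> (forall y, exists x, f x = y) ->
  isomorphic G H.
Proof.
move=> fM f_inj f_surj.
pose fMixin := isMultiplicative.Build G H f fM.
pose fm : {multiplicative G -> H} := HB.pack f fMixin.
have f_surjb y : exists x, f x == y by have [x <-] := f_surj y; exists x.
exists fm; exists (fun y => xchoose (f_surjb y)) => [x|y].
  by apply: f_inj; apply/eqP: (xchooseP (f_surjb (f x))).
exact/eqP/(xchooseP (f_surjb y)).
Qed.

Lemma isomorphic_sym (G H : groupType) : isomorphic G H -> isomorphic H G.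
Proof.
move=> [f [g fK gK]]; apply: (@isomorphicP _ _ g) => [x y||x].
- by apply: (can_inj fK); rewrite gK gmulfM !gK.
- exact: can_inj gK.
- by exists (f x).
Qed.

Lemma isomorphic_trans (G H J : groupType) :
  isomorphic G H -> isomorphic H J -> isomorphic G J.
Proof.
move=> [f f_bij] [g g_bij]; have gf_bij := bij_comp g_bij f_bij.
apply: (@isomorphicP _ _ (g \o f)) => [x y||z].
- by rewrite /= !gmulfM.
- exact: bij_inj gf_bij.
- by have [h _ hK] := gf_bij; exists (h z).
Qed.

Lemma star_valX (K : fieldType) (x : star K) m :
  star_val (x ^+ m)%g = star_val x ^+ m.
Proof. by elim: m => // m IHm; rewrite expgS exprS -IHm. Qed.

(** The witness z may range over all of K, since it is nonzero as soon as x is. *)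
Lemma powcl_eqP (K : fieldType) m (x y : star K) : (0 < m)%N ->
  reflect (exists z, star_val x = star_val y * z ^+ m)
          (\pi_(powcl K m) x == \pi_(powcl K m) y).
Proof.
move=> m_gt0; have yx_neq0 := star_neq0 y.
apply: (iffP (powclP m x y)) => [[z xyz]|[z xyz]].
  exists (star_val z); rewrite -star_valX -xyz mulrC.
  exact: esym (divfK yx_neq0 _).
have z_neq0 : z != 0.
  apply: contraNneq (star_neq0 x) => z0.
  by rewrite xyz z0 expr0n gtn_eqF // mulr0.
exists (Star z_neq0); apply/val_inj; rewrite /= star_valX /= xyz.
by rewrite mulrAC mulfV // mul1r.
Qed.

(** The three conditions on f give in turn that classes from K are fixed, injectivity, and
    surjectivity. The source is an arbitrary field, so that F itself can be taken. *)
Lemma powcl_fix_isomorphic (F : fieldType) (E : splittingFieldType F)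
    (M : {subfield E}) (m : nat) (G : {set gal_of M})
    (K : fieldType) (f : {rmorphism K -> subvs_of M}) :
  (0 < m)%N ->
  (forall s, s \in G -> forall x, gal_res s (f x) = f x) ->
  (forall x y, f x = y ^+ m -> exists w, x = w ^+ m) ->
  (forall y, y != 0 ->
    (forall s, s \in G -> exists z, gal_res s y = y * z ^+ m) ->
    exists w, w != 0 /\ exists x, f x = y * w ^+ m) ->
  isomorphic (powcl K m) (powcl_fix m G).
Proof.
move=> m_gt0 f_fix f_descent class_fix.
have fix_f a : gal_fixed G (powcl_map f (m := m) a).
  apply/forall_inP=> s Gs; elim/powclW: a => x; rewrite !powcl_map_pi.
  by apply/eqP; congr (\pi _); apply/val_inj/f_fix.
apply: (@isomorphicP _ _ (fun a => PowclFix (fix_f a))) => [a b|a b|[b fix_b]].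
- by apply/val_inj; apply: powcl_mapM.
- move/(congr1 val); rewrite /=; elim/powclW: a => x; elim/powclW: b => y.
  rewrite !powcl_map_pi => /eqP/(powcl_eqP _ _ m_gt0)[z fxy].
  have {}fxy : f (star_val x) = f (star_val y) * z ^+ m by apply: fxy.
  have y_neq0 := star_neq0 y.
  (* Injectivity: the quotient x / y becomes an m-th power in M. *)
  have [|w xyw] := f_descent (star_val x / star_val y) z.
    by rewrite fmorph_div fxy mulrC mulKf // fmorph_eq0.
  apply/eqP/(powcl_eqP _ _ m_gt0); exists w.
  by rewrite -xyw mulrC divfK.
- elim/powclW: b fix_b => y fix_y.
  have [|w [w_neq0 [x fx]]] := class_fix _ (star_neq0 y).
    move=> s Gs; have /forall_inP/(_ s Gs) := fix_y.
    rewrite powcl_map_pi => /(powcl_eqP _ _ m_gt0)[z sy].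
    by exists z; apply: sy.
  have x_neq0 : x != 0.
    by rewrite -(fmorph_eq0 f) fx mulf_neq0 ?expf_neq0 ?star_neq0.
  exists (\pi_(powcl K m) (Star x_neq0)); apply/val_inj; rewrite /= powcl_map_pi.
  by apply/eqP/(powcl_eqP _ _ m_gt0); exists w.
Qed.

(* The inclusion takes a proof of [L <= M] as an argument only so that its
   ring morphism structure, which depends on that proof, can be inferred. *)
Definition subvs_incl (F : fieldType) (E : splittingFieldType F)
    (L M : {subfield E}) of (L <= M)%VS :=
  fun x : subvs_of L => vsproj M (vsval x).

Section SubfieldInclusion.

Variables (F : fieldType) (E : splittingFieldType F) (L M : {subfield E}).
Hypothesis sLM : (L <= M)%VS.

Lemma subvs_inclE x : vsval (subvs_incl sLM x) = vsval x.
Proof. by rewrite vsprojK // (subvP sLM) // subvsP. Qed.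

Fact subvs_incl_is_zmod_morphism : zmod_morphism (subvs_incl sLM).
Proof. by move=> x y; rewrite /subvs_incl !linearB. Qed.
Fact subvs_incl_is_monoid_morphism : monoid_morphism (subvs_incl sLM).
Proof.
have valE (a : subvs_of M) : val a = vsval a by [].
split=> [|x y]; apply: (@val_inj _ _ (subvs_of M)); rewrite !valE.
  by rewrite subvs_inclE !(rmorph1 vsval).
by rewrite [RHS]rmorphM /= !subvs_inclE -rmorphM.
Qed.
HB.instance Definition _ := GRing.isZmodMorphism.Build
  (subvs_of L) (subvs_of M) (subvs_incl sLM) subvs_incl_is_zmod_morphism.
HB.instance Definition _ := GRing.isMonoidMorphism.Build
  (subvs_of L) (subvs_of M) (subvs_incl sLM) subvs_incl_is_monoid_morphism.

End SubfieldInclusion.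

(** Transfers the criterion to elements of E, where K is the image of [f]. *)
Lemma powcl_fix_gal_isomorphic (F : fieldType) (E : splittingFieldType F)
    (K M : {subfield E}) (m : nat)
    (K0 : fieldType) (f : {rmorphism K0 -> subvs_of M}) :
  (0 < m)%N -> (K <= M)%VS ->
  (forall x, reflect (exists k, vsval (f k) = x) (x \in K)) ->
  (forall y, y \in M -> y ^+ m \in K -> exists2 w, w \in K & w ^+ m = y ^+ m) ->
  (forall y, y \in M -> y != 0 ->
     (forall s, s \in 'Gal(M / K)%g ->
       exists2 z, z \in M & s y = y * z ^+ m) ->
     exists w, [/\ w \in M, w != 0 & y * w ^+ m \in K]) ->
  isomorphic (powcl K0 m) (powcl_fix m 'Gal(M / K)%g).
Proof.
move=> m_gt0 sKM imf root_desc class_desc.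
have val_inj_M : injective (vsval : subvs_of M -> E) by apply: val_inj.
have vsvalX (K' : {subfield E}) (x : subvs_of K') : vsval (x ^+ m) = vsval x ^+ m.
  exact: (rmorphXn vsval).
apply: (@powcl_fix_isomorphic _ _ _ _ _ _ f) => // [s Gs x|x y fx|y y_neq0 y_fix].
- apply: val_inj_M; rewrite gal_resE (fixed_gal sKM Gs) //.
  by apply/imf; exists x.
- have [||_ /imf[w <-] wy] := root_desc (vsval y); first exact: subvsP.
    by rewrite -vsvalX -fx; apply/imf; exists x.
  exists w; apply: (fmorph_inj f); apply: val_inj_M.
  by rewrite rmorphXn vsvalX wy -vsvalX fx.
- have [|||w [Mw w_neq0 /imf[x fx]]] := class_desc (vsval y).
  + exact: subvsP.
  + by rewrite (fmorph_eq0 vsval).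
  + move=> s /y_fix[z sy]; exists (vsval z); first exact: subvsP.
    by rewrite -gal_resE sy (rmorphM vsval) /= vsvalX.
  exists (vsproj M w); split.
    by rewrite -(fmorph_eq0 vsval) /= vsprojK.
  exists x; apply: val_inj_M.
  by rewrite fx (rmorphM vsval) /= vsvalX vsprojK.
Qed.

Lemma in_alg_subvsP (F : fieldType) (E : splittingFieldType F)
    (K : {subfield E}) (x : E) :
  reflect (exists k, vsval (in_alg (subvs_of K) k) = x) (x \in 1%AS).
Proof.
have vsval_alg k : vsval (in_alg (subvs_of K) k) = k%:A.
  rewrite -[in_alg _ _]/(k *: 1) linearZ; congr (k *: _).
  exact: (rmorph1 vsval).
by apply: (iffP (vlineP _ _)) => -[k xE]; exists k; move: xE; rewrite vsval_alg.
Qed.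

(** As L is normal over K, t restricts to an element of Gal(L/K) with the same value at y. Invariant
    classes of L thus stay invariant in M. *)
Lemma gal_class_lift (F : fieldType) (E : splittingFieldType F)
    (K L M : {subfield E}) (m : nat) (y : E) :
  (K <= L <= M)%VS -> galois K L -> galois K M -> y \in L ->
  (forall s, s \in 'Gal(L / K)%g -> exists2 z, z \in L & s y = y * z ^+ m) ->
  forall t, t \in 'Gal(M / K)%g -> exists2 z, z \in M & t y = y * z ^+ m.
Proof.
move=> sKLM /and3P[_ _ nKL] galKM Ly y_fix t Gt.
have [|z Lz ty] := y_fix (normalField_cast L t).
  by rewrite -(normalField_img galKM sKLM nKL) mem_morphim.
exists z; first by case/andP: sKLM => _ /subvP->.
by rewrite -ty (normalField_cast_eq sKLM nKL).
Qed.

Theorem corollary1p11 (p n : nat) (F : fieldType) (E : splittingFieldType F)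
    (L M : {subfield E})
    (p_prime : prime p) (p_odd : odd p) (n_ge1 : (1 <= n)%N)
    (charF : p \notin [pchar F]%R)
    (LE : is_adjoin_mu p L) (ME : is_adjoin_mu (p ^ n)%N M)
    (mu_p_notF : ~ mu_sub_base E p) :
  isomorphic (powcl (subvs_of L) (p ^ n)) (powcl_fix (p ^ n) 'Gal(M / L)%g)
  /\ (isomorphic (powcl F (p ^ n)) (powcl_fix (p ^ n) 'Gal(L / 1%AS)%g)
      /\ isomorphic (powcl_fix (p ^ n) 'Gal(L / 1%AS)%g)
                    (powcl_fix (p ^ n) 'Gal(M / 1%AS)%g)).
Proof.
have p_neq0 : p%:R != 0 :> F by move: charF; rewrite inE p_prime.
have q_gt0 : (0 < p ^ n)%N by rewrite expn_gt0 prime_gt0.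
have [gal1L [omega prim_omega defL]] := adjoin_mu_primitive_root p_neq0 LE.
have [|gal1M [zeta prim_zeta defM]] := adjoin_mu_primitive_root _ ME.
  by rewrite natrX expf_neq0.
(* As n >= 1, omega is also a p^n-th root of unity, hence a power of zeta. *)
have sLM : (L <= M)%VS.
  rewrite defL; apply/FadjoinP; split; first exact: sub1v.
  have /(prim_rootP prim_zeta)[i ->] : omega ^+ (p ^ n) = 1.
    by rewrite -(prednK n_ge1) expnS exprM (prim_expr_order prim_omega) expr1n.
  by rewrite rpredX // defM memv_adjoin.
have galLM : galois L M by apply: galoisS gal1M; rewrite sub1v.
have defML : M = <<L; zeta>>%AS.
  apply/val_inj/eqP; rewrite eqEsubv /= {1}defM; apply/andP; split.
    by apply/FadjoinP; rewrite sub1v memv_adjoin.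
  by apply/FadjoinP; rewrite sLM defM memv_adjoin.
have rootLM := pfactor_root_descent p_prime p_odd n_ge1 prim_zeta defML galLM.
have classLM := pfactor_class_descent p_prime p_odd n_ge1 prim_zeta defML galLM.
have root1M := pfactor_root_descent p_prime p_odd n_ge1 prim_zeta defM gal1M.
have class1M := pfactor_class_descent p_prime p_odd n_ge1 prim_zeta defM gal1M.
have isoFM : isomorphic (powcl F (p ^ n)) (powcl_fix (p ^ n) 'Gal(M / 1%AS)%g).
  apply: (powcl_fix_gal_isomorphic (f := in_alg (subvs_of M))) => //.
    exact: sub1v.
  exact: in_alg_subvsP.
(* L may lack the p^n-th roots of unity, so the descent from L to F runs through M. *)
have isoFL : isomorphic (powcl F (p ^ n)) (powcl_fix (p ^ n) 'Gal(L / 1%AS)%g).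
  apply: (powcl_fix_gal_isomorphic (f := in_alg (subvs_of L))) => //.
  - exact: sub1v.
  - exact: in_alg_subvsP.
  - by move=> y /(subvP sLM); apply: root1M.
  - move=> y Ly y_neq0 y_fix.
    have [|//|w [Mw w_neq0 yw]] := class1M y _ y_neq0; first exact: (subvP sLM).
      by apply: gal_class_lift gal1L gal1M Ly y_fix; rewrite sub1v.
    (* Here w^q = (y w^q) / y lies in L, so some v in L has the same q-th power as w. *)
    have [|v Lv vw] := rootLM w Mw.
      rewrite -[w ^+ _](mulKf y_neq0) rpredM ?rpredV //.
      by apply: subvP yw; apply: sub1v.
    exists v; rewrite vw; split=> //.
    apply: contraNneq (expf_neq0 (p ^ n) w_neq0) => v0.
    by rewrite -vw v0 expr0n gtn_eqF.
split; last first.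
  (* Both groups of fixed classes are compared through the power classes of F. *)
  by split=> //; apply: isomorphic_trans isoFM; apply: isomorphic_sym.
apply: (powcl_fix_gal_isomorphic (f := subvs_incl sLM)) => //.
move=> x; apply: (iffP idP) => [Lx|[k <-]].
  by exists (vsproj L x); rewrite subvs_inclE vsprojK.
by rewrite subvs_inclE subvsP.
Qed.
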